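(* Let $\Gamma$ be a piecewise $C^2$ graph in $\mathbb{R}^3$. For any $q\in\Gamma$, $$\mathrm{ntc}(q)=\frac12\int_{S^2}\big[\mathrm{nlm}(e,q)\big]^+\,dA_{S^2}(e).$$
   Context: $\Gamma$ is a connected finite graph; after adding finitely many vertices of degree 2, each edge is a regular $C^2$ arc up to its endpoints. The degree $d(q)$ of a vertex is the number of edges ending at it (loops count twice); an interior point of an edge is regarded as a vertex of degree 2. At $q$ of degree $d$ let $T_1,\dots,T_d\in S^2$ be the unit tangent vectors pointing into the edges ending at $q$. Let $\chi_i:S^2\to\{-1,+1\}$ be $-1$ on the hemisphere centered at $T_i$ and $+1$ on the opposite hemisphere (modulo null sets), and $\mathrm{ntc}(q)=\frac14\int_{S^2}\big[\sum_{i=1}^d\chi_i(e)\big]^+dA_{S^2}(e)$, with $[x]^+=\max(x,0)$. The double $\widetilde\Gamma$ of $\Gamma$ has the same vertices and two copies of each edge. A parameterization $\Gamma'$ of $\widetilde\Gamma$ is a mapping from a (not necessarily connected) compact 1-manifold without boundary which covers each edge of $\widetilde\Gamma$ exactly once; $d(q)$ points $q_1,\dots,q_d$ of $\Gamma'$ lie over $q$. For $e\in S^2$, $\mathrm{lmax}(e,q)$ and $\mathrm{lmin}(e,q)$ are the numbers of local maxima and local minima of $\langle e,\cdot\rangle$ along $\Gamma'$ among $q_1,\dots,q_d$, and $\mathrm{nlm}(e,q)=\frac12[\mathrm{lmax}(e,q)-\mathrm{lmin}(e,q)]$, which is defined for almost all $e$ and does not depend on the choice of $\Gamma'$. *)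

(* Defs.v *)
From HB Require Import structures.
From mathcomp Require Import all_boot all_order all_algebra finmap.
From mathcomp Require Import all_classical all_reals all_analysis.

Set Implicit Arguments.
Unset Strict Implicit.
Unset Printing Implicit Defensive.

Import Order.TTheory GRing.Theory Num.Theory.
Import numFieldNormedType.Exports.

Local Open Scope classical_set_scope.
Local Open Scope ring_scope.

(* The library norm `|u| on 'rV_3 is the sup norm; it only provides the
   topology. The Euclidean structure is given by dotv and enorm. *)
Definition dotv (R : realType) (u v : 'rV[R]_3) : R := \sum_i u 0 i * v 0 i.

Definition enorm (R : realType) (u : 'rV[R]_3) : R := Num.sqrt (dotv u u).

Definition sph (R : realType) (theta phi : R) : 'rV[R]_3 :=
  \row_i [:: sin theta * cos phi; sin theta * sin phi; cos theta]`_i.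

(* The integral of f over the unit sphere against its area measure, which in
   the coordinates sph (colatitude theta, longitude phi) is
   sin theta dtheta dphi. *)
Definition sphere_integral (R : realType) (f : 'rV[R]_3 -> R) : \bar R :=
  (\int[lebesgue_measure \x lebesgue_measure]_(x in
      `[0%R, pi] `*` `[0%R, (2 * pi)%R])
    (f (sph x.1 x.2) * sin x.1)%:E)%E.

(* c is regular of class C^2 on [a, b], up to the endpoints: on [a, b] it
   coincides with a C^2 map c1 on the line whose derivative does not vanish
   on [a, b]. *)
Definition regular_C2 (R : realType) (a b : R) (c : R -> 'rV[R]_3) : Prop :=
  exists c1 : R -> 'rV[R]_3,
    [/\ forall t, derivable c1 t 1,
        forall t, derivable (derive1 c1) t 1,
        continuous (derive1 (derive1 c1)),
        forall t, t \in `[a, b] -> c t = c1 t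
      & forall t, t \in `[a, b] -> derive1 c1 t != 0].

(* s is the list of parameters of the vertices of degree 2 to be added. *)
Definition piecewise_C2 (R : realType) (c : R -> 'rV[R]_3) : Prop :=
  exists s : seq R, path <%R 0 (rcons s 1) /\
    forall i, (i <= size s)%N ->
      regular_C2 (0 :: rcons s 1)`_i (0 :: rcons s 1)`_i.+1 c.

(* A finite connected graph mapped to R^3. Each edge e is parameterized by
   [0, 1] (the values of edge_arc e elsewhere are irrelevant); ends e false and
   ends e true are its end vertices at the parameters 0 and 1. Loops and
   multiple edges are allowed. The map to R^3 is not required to be injective:
   points of the graph are points of the abstract graph (see gpoint). *)
Record pwC2graph (R : realType) := PwC2Graph {
  vert : finType;
  edge : finType;
  ends : edge -> bool -> vert;
  pos : vert -> 'rV[R]_3;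
  edge_arc : edge -> R -> 'rV[R]_3;
  arc_start : forall e, edge_arc e 0 = pos (ends e false);
  arc_end : forall e, edge_arc e 1 = pos (ends e true);
  arc_C2 : forall e, piecewise_C2 (edge_arc e);
  graph_connected : forall u v : vert,
    connect (fun x y => [exists e, exists b : bool,
      (ends e b == x) && (ends e (~~ b) == y)]) u v }.

Inductive gpoint (R : realType) (G : pwC2graph R) : Type :=
  | GVert of vert G
  | GEdge of edge G & {t : R | 0 < t < 1}.

Definition point_map (R : realType) (G : pwC2graph R) (p : gpoint G) :
    'rV[R]_3 :=
  match p with GVert v => pos v | GEdge e t => edge_arc e (val t) end.

(* The characteristic map of the closed edge e, extended to the line by the
   value at 0 for t <= 0 and by the value at 1 for t >= 1. *)
Definition edge_point (R : realType) (G : pwC2graph R) (e : edge G) (t : R) :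
    gpoint G :=
  if (insub t : option {t : R | 0 < t < 1}) is Some t' then GEdge e t'
  else GVert (ends e (1 <= t)).

HB.instance Definition _ (R : realType) (G : pwC2graph R) :=
  gen_eqMixin (gpoint G).
HB.instance Definition _ (R : realType) (G : pwC2graph R) :=
  gen_choiceMixin (gpoint G).

(* The CW topology: a set is open iff it meets every closed edge in an open
   subset of that edge (edge_point being constant outside of ]0, 1[, openness
   of the preimage in the line is relative openness in [0, 1]). *)
Definition point_open (R : realType) (G : pwC2graph R) : set (set (gpoint G)) :=
  [set O | forall e : edge G, open (edge_point e @^-1` O)].

Lemma point_openT (R : realType) (G : pwC2graph R) :
  @point_open R G [set: gpoint G].
Proof. by move=> e; rewrite preimage_setT; exact: openT. Qed.

Lemma point_openI (R : realType) (G : pwC2graph R) (A B : set (gpoint G)) :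
  point_open A -> point_open B -> point_open (A `&` B).
Proof. by move=> oA oB e; rewrite preimage_setI; exact: openI. Qed.

Lemma point_open_bigU (R : realType) (G : pwC2graph R) (I : Type)
    (f : I -> set (gpoint G)) :
  (forall i, point_open (f i)) -> point_open (\bigcup_i f i).
Proof.
by move=> of_ e; rewrite preimage_bigcup; apply: bigcup_open => i _; exact: of_.
Qed.

HB.instance Definition _ (R : realType) (G : pwC2graph R) :=
  isOpenTopological.Build (gpoint G)
    (@point_openT R G) (@point_openI R G) (@point_open_bigU R G).

(* The one-sided unit tangent vector of c at t, pointing in the direction of
   decreasing parameters if b, of increasing parameters otherwise. *)
Definition unit_tangent (R : realType) (c : R -> 'rV[R]_3) (b : bool) (t : R) :
    'rV[R]_3 :=
  let D := lim ((fun h : R => h^-1 *: (c (t + (-1) ^+ b * h) - c t)) @ 0^'+) in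
  (enorm D)^-1 *: D.

(* T_1, ..., T_d at q. At a vertex there is one vector for each edge end at it
   (two for a loop); an end h = (e, b) is at the parameter h.2 of e. *)
Definition tangents (R : realType) (G : pwC2graph R) (q : gpoint G) :
    seq 'rV[R]_3 :=
  match q with
  | GVert v =>
      [seq unit_tangent (edge_arc h.1) h.2 h.2%:R
         | h : edge G * bool <- enum {: edge G * bool} & ends h.1 h.2 == v]
  | GEdge e t =>
      [:: unit_tangent (edge_arc e) true (val t);
          unit_tangent (edge_arc e) false (val t)]
  end.

(* The value on the equator, a null set, is conventional. *)
Definition chi (R : realType) (T e : 'rV[R]_3) : R :=
  if 0 <= dotv e T then -1 else 1.

Definition pospart (R : realType) (x : R) : R := Num.max x 0.

Definition ntc (R : realType) (G : pwC2graph R) (q : gpoint G) : \bar R :=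
  ((4^-1)%:E *
    sphere_integral (fun e => pospart (\sum_(T <- tangents q) chi T e)%R))%E.

Section Double.
Variables (R : realType) (G : pwC2graph R).

Let ends2 (e : edge G * bool) := @ends R G e.1.
Let arc2 (e : edge G * bool) := @edge_arc R G e.1.

Lemma double_connected (u v : vert G) :
  connect (fun x y => [exists e, exists b : bool,
    (ends2 e b == x) && (ends2 e (~~ b) == y)]) u v.
Proof.
have := graph_connected u v; apply: connect_sub => x y.
move=> /existsP[e /existsP[b exy]]; apply: connect1.
by apply/existsP; exists (e, true); apply/existsP; exists b.
Qed.

Definition double_graph : pwC2graph R :=
  @PwC2Graph R (vert G) (edge G * bool)%type ends2 (@pos R G) arc2
    (fun e => arc_start e.1) (fun e => arc_end e.1) (fun e => arc_C2 e.1)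
    double_connected.

Definition undouble (p : gpoint double_graph) : gpoint G :=
  match p with
  | GVert v => @GVert R G v
  | GEdge e t => @GEdge R G e.1 t
  end.

End Double.

(* Compact topological manifold of dimension 1 without boundary: compact,
   Hausdorff, and each point has an open neighborhood U homeomorphic to the
   line via h, with inverse k. Second countability is implied; M may be empty
   or disconnected. *)
Definition closed_1manifold (R : realType) (M : topologicalType) : Prop :=
  [/\ compact [set: M], hausdorff_space M
    & forall x : M, exists (U : set M) (h : M -> R) (k : R -> M),
        [/\ open U, U x, {within U, continuous h}, continuous k
          & (forall y, U y -> k (h y) = y) /\
            (forall t, U (k t) /\ h (k t) = t)]].

(* A parameterization of H by M: each interior point of an edge is covered
   exactly once, and no arc of M is collapsed to a vertex. *)
Definition parameterization (R : realType) (M : topologicalType)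
    (H : pwC2graph R) (f : M -> gpoint H) : Prop :=
  [/\ continuous f,
      forall (e : edge H) (t : {t : R | 0 < t < 1}),
        exists! x : M, f x = GEdge e t
    & forall v : vert H, finite_set (f @^-1` [set GVert v])].

Section LocalExtrema.
Variables (R : realType) (G : pwC2graph R) (M : topologicalType).
Variable f : M -> gpoint (double_graph G).

Definition height (e : 'rV[R]_3) (x : M) : R := dotv e (point_map (f x)).

(* Local extrema are not required to be strict. For a parameterization f the
   sets below are finite (fset_set would send an infinite set to the empty
   one). *)
Definition lmax (e : 'rV[R]_3) (q : gpoint G) : nat :=
  #|` fset_set [set x : M | undouble (f x) = q /\
        \forall y \near x, height e y <= height e x] |%fset.

Definition lmin (e : 'rV[R]_3) (q : gpoint G) : nat :=
  #|` fset_set [set x : M | undouble (f x) = q /\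
        \forall y \near x, height e x <= height e y] |%fset.

Definition nlm (e : 'rV[R]_3) (q : gpoint G) : R :=
  2^-1 * ((lmax e q)%:R - (lmin e q)%:R).

End LocalExtrema.

(* Main.v *)
Require Import Defs.
From HB Require Import structures.
From mathcomp Require Import all_boot all_order all_algebra finmap.
From mathcomp Require Import all_classical all_reals all_analysis.
From mathcomp Require Import measurable_realfun.
From mathcomp Require Import ring lra.

Set Implicit Arguments.
Unset Strict Implicit.
Unset Printing Implicit Defensive.

Import Order.TTheory GRing.Theory Num.Theory.
Import numFieldNormedType.Exports.

Local Open Scope classical_set_scope.
Local Open Scope ring_scope.

(** Over q, the double graph has two copies of each of the d edge ends at q, so
    a parameterization f of the double graph passes through q along 2d
    one-sided arcs, and each point over q uses exactly two of them: its two
    sides in the 1-manifold. Fix e not orthogonal to any of the tangents T_i.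
    Along the arc with tangent T_i the height starts by increasing if
    dotv e T_i is positive and by decreasing otherwise, so chi T_i e is -1 or 1
    accordingly. A point over q is a local maximum iff the heights decrease on
    both sides, a local minimum iff they increase on both sides; hence twice
    (lmax - lmin) at that point is the sum of the values of chi on its two
    sides. Summing over the points over q, each T_i is counted twice, once per
    copy: lmax - lmin = sum_i chi T_i e, so that nlm = (1/2) sum_i chi T_i e,
    and the two integrands agree off finitely many great circles.

    The topological heart is the bijection between the arcs of the double graph
    at q and the sides of the points over q. It is isolated as a statement on a
    closed 1-manifold M with a function tau (the distance to q along the edges)
    whose punctured tubes 0 < tau < r split into open branches, each mapped
    bijectively to ]0, r[ by tau. Each side of a zero of tau is connected, so it
    lies in one branch, and by the intermediate value theorem it exhausts the
    small values of tau there (arm_branch); so distinct sides lie in distinct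
    branches (two_branches). Conversely compactness of M gives each branch a
    limit point (branch_limit). The count of extrema follows
    (signed_extrema_count).

    On the analytic side, unit_tangentP derives the behavior of the height from
    the one-sided derivative of the arc, great_circle_null shows that great
    circles are null by Fubini at fixed longitude, and
    ge0_eq_integral_off_null compares the integrals without knowing that
    nlm is measurable: it is controlled only off a null set. *)

(** * Branches at the zeros of a function on a closed 1-manifold *)

(** tau stands for the distance to a point of a graph and W i for the i-th arc
    issued from it; P selects the indices of actual arcs, so that I can be any
    finite type of candidates. *)
Record branching (R : realType) (M : topologicalType) (I : finType)
    (tau : M -> R) (r : R) (P : pred I) (W : I -> set M) : Prop := Branching {
  br_cont : continuous tau;
  br_ge0 : forall y, 0 <= tau y;
  br_finite : finite_set (tau @^-1` [set 0]);
  br_radius : 0 < r;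
  br_open : forall i, open (W i);
  br_gt0 : forall i y, W i y -> 0 < tau y;
  br_disjoint : forall i j y, W i y -> W j y -> i = j;
  br_cover : forall y, 0 < tau y < r -> exists i, W i y;
  br_valid : forall i y, W i y -> P i;
  br_inj : forall i x y, W i x -> W i y -> tau x = tau y -> x = y;
  br_onto : forall i h, P i -> 0 < h < r -> exists2 y, W i y & tau y = h }.

Section Branching.
Variables (R : realType) (M : topologicalType) (I : finType).
Variables (tau : M -> R) (r : R) (P : pred I) (W : I -> set M).
Hypothesis manM : closed_1manifold R M.
Hypothesis brW : branching tau r P W.

(** The whole arc converges to x as tau tends to 0. This is stronger than
    accumulation at x, and makes the end unique in a Hausdorff space. *)
Definition branch_to (i : I) (x : M) : Prop :=
  forall N, nbhs x N -> exists2 d, 0 < d & forall y, W i y -> tau y < d -> N y.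

(** The arm k(]0, d[) is connected and covered by the disjoint open branches, so
    it stays in a single one. As tau vanishes at its origin, the intermediate
    value theorem on [0, s1] shows that the arm takes every small value of tau;
    tau being injective on the branch, the arm contains the whole germ of the
    branch. *)
Lemma arm_branch (k : R -> M) (d : R) :
  continuous k -> injective k -> tau (k 0) = 0 -> 0 < d ->
  (forall s, 0 < s < d -> 0 < tau (k s) < r) ->
  exists i, (forall s, 0 < s < d -> W i (k s)) /\
    forall e, 0 < e -> exists2 u, 0 < u &
      forall y, W i y -> tau y < u -> exists2 s, 0 < s < e & k s = y.
Proof.
move=> kc kinj k0 d0 kd.
have [|i Wi] := br_cover brW (y := k (d / 2)); first by apply: kd; lra.
have kW s : 0 < s < d -> W i (k s).
  (* Clopen argument: the complement of W i along the arm is the union of the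
     other branches. *)
  have cA : connected (`]0, d[%classic : set R).
    by apply/connected_intervalP; exact: interval_is_interval.
  have E : `]0, d[%classic `&` k @^-1` W i = `]0, d[%classic.
    apply: cA.
    - by exists (d / 2); split => //=; rewrite in_itv /=; lra.
    - exists (k @^-1` W i) => //; apply: open_comp => [x _|]; first exact: kc.
      exact: (br_open brW).
    - exists (~` (k @^-1` (\bigcup_(j in [set j | j != i]) W j))).
        apply: open_closedC; apply: open_comp => [x _|]; first exact: kc.
        by apply: bigcup_open => j _; exact: (br_open brW).
      apply/seteqP; split => t /= [td].
        move=> Wt; split=> // -[j /= ji Wj].
        by move/eqP: ji; apply; exact: (br_disjoint brW Wj Wt).
      move=> Wt; split=> //.
      have [|j Wj] := br_cover brW (y := k t).
        by apply: kd; move: td; rewrite in_itv.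
      have [<-//|ji] := eqVneq j i.
      by exfalso; apply: Wt; exists j.
  by move=> sd; have : `]0, d[%classic s by []; rewrite -E => -[].
exists i; split=> // e e0.
pose s1 := Num.min d e / 2.
have me : Num.min d e <= e by rewrite ge_min lexx orbT.
have md : Num.min d e <= d by rewrite ge_min lexx.
have m0 : 0 < Num.min d e by rewrite lt_min d0 e0.
have s1d : 0 < s1 < d by rewrite /s1; lra.
exists (tau (k s1)); first by case/andP: (kd _ s1d).
move=> y Wy ys.
have y0 := br_gt0 brW Wy.
have [|||s] := @IVT R (tau \o k) 0 s1 (tau y).
- by case/andP: s1d => /ltW.
- apply: continuous_subspaceT => z; apply: continuous_comp; first exact: kc.
  exact: (br_cont brW).
- by rewrite /= k0 ge_min le_max (ltW y0) (ltW ys) orbT.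
rewrite in_itv /= => /andP[s_ge0 s_le] ksy.
have s0 : 0 < s.
  by rewrite lt0r s_ge0 andbT; apply/eqP => s0; move: y0;
    rewrite -ksy s0 k0 ltxx.
exists s; first by rewrite s0; rewrite /s1 in s_le; lra.
by apply: (br_inj brW (kW _ _) Wy) => //; move: s1d; lra.
Qed.

Lemma arm_branch_to (k : R -> M) (i : I) : {for 0, continuous k} ->
  (forall e, 0 < e -> exists2 u, 0 < u &
    forall y, W i y -> tau y < u -> exists2 s, 0 < s < e & k s = y) ->
  branch_to i (k 0).
Proof.
move=> kc karm N xN.
have /nbhs_ballP[e /= e0 eN] : nbhs 0 (k @^-1` N) by exact: kc.
have [u u0 ku] := karm _ e0; exists u => // y Wy yu.
have [s /andP[s0 se] <-] := ku y Wy yu.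
by apply: eN; rewrite /ball /= sub0r normrN gtr0_norm.
Qed.

(** In a chart centered at x the two half-lines are arms, whose branches differ
    because the chart is injective whereas each arm contains the germ of its
    branch. *)
Lemma two_branches (x : M) : tau x = 0 ->
  exists i j, [/\ i != j, P i /\ branch_to i x, P j /\ branch_to j x &
    \forall y \near x, y = x \/ W i y \/ W j y].
Proof.
move=> x0; have [_ _ /(_ x)[U [h [k [oU Ux hc kc [kh hk]]]]]] := manM.
pose k1 s := k (h x + s); pose k2 s := k (h x - s).
have k10 : k1 0 = x by rewrite /k1 addr0 kh.
have k20 : k2 0 = x by rewrite /k2 subr0 kh.
have kinj : injective k.
  by move=> a b /(congr1 h); rewrite (proj2 (hk a)) (proj2 (hk b)).
have k1c : continuous k1.
  by move=> s; apply: continuous_comp; [apply: cvgD;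
    [exact: cvg_cst|exact: cvg_id]|exact: kc].
have k2c : continuous k2.
  by move=> s; apply: continuous_comp; [apply: cvgB;
    [exact: cvg_cst|exact: cvg_id]|exact: kc].
have k1inj : injective k1 by move=> a b /kinj /addrI.
have k2inj : injective k2 by move=> a b /kinj /addrI /oppr_inj.
have [d d0 kd] : exists2 d, 0 < d &
    forall s, `|s| < d -> s != 0 -> 0 < tau (k1 s) < r.
  have : \forall s \near (0 : R), tau (k1 s) < r.
    have tc : tau (k1 s) @[s --> (0 : R)] --> tau (k1 0).
      by apply: continuous_comp; [exact: k1c|exact: (br_cont brW)].
    by apply: (cvgr_lt _ tc); rewrite k10 x0; exact: (br_radius brW).
  (* The zeros of tau are finitely many, so they do not accumulate at x. *)
  have : \forall s \near (0 : R), s != 0 -> tau (k1 s) != 0.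
    pose F := (tau \o k1) @^-1` [set 0] `\ 0.
    have Ff : finite_set F.
      apply: finite_setD.
      rewrite comp_preimage; apply: finite_preimage;
        last exact: (br_finite brW).
      by move=> a b _ _; exact: k1inj.
    have : open (~` F).
      apply: closed_openC; apply: compact_closed; first exact: Rhausdorff.
      exact: finite_compact.
    move=> oF; have : nbhs 0 (~` F) by apply: open_nbhs_nbhs; split=> [//|[_]];
      exact.
    by apply: filterS => s Fs /eqP sn0; apply/eqP => ts; apply: Fs.
  move=> H1 H2; 
  have /nbhs_ballP[d /= d0 dH] : nbhs (0 : R)
      [set s | (s != 0 -> tau (k1 s) != 0) /\ tau (k1 s) < r] by exact: filterI.
  exists d => // s sd sn0; have [] := dH s;
    first by rewrite /ball /= sub0r normrN.
  move=> /(_ sn0) ts0 ->; rewrite andbT lt0r ts0; exact: (br_ge0 brW).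
have [||i [Wi ki]] := arm_branch k1c k1inj _ d0.
- by rewrite k10.
- move=> s /andP[s0 sd]; apply: kd; first by rewrite gtr0_norm.
  by rewrite gt_eqF.
have [||j [Wj kj]] := arm_branch k2c k2inj _ d0.
- by rewrite k20.
- move=> s /andP[s0 sd].
  have -> : k2 s = k1 (- s) by [].
  apply: kd; first by rewrite normrN gtr0_norm.
  by rewrite oppr_eq0 gt_eqF.
exists i, j; split; last first.
- have hx : h @ x --> h x.
    by move: hc; rewrite continuous_open_subspace// => /(_ x); rewrite inE;
      exact.
  have : \forall y \near x, `|h x - h y| < d.
    by move/cvgrPdist_lt: hx => /(_ _ d0).
  move: (open_nbhs_nbhs (conj oU Ux)) => xU.
  apply: filterS2 xU => y Uy; have [hxy|yx] := eqVneq (h y) (h x).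
    by move=> _; left; rewrite -(kh _ Ux) -hxy (kh _ Uy).
  move=> yd; right; rewrite -(kh _ Uy).
  have [hl|hg] := ltP (h x) (h y).
    left; have -> : h y = h x + (h y - h x) by lra.
    by apply: Wi; move: yd; rewrite ltr_norml; lra.
  right; have -> : h y = h x - (h x - h y) by lra.
  by apply: Wj; move: yd; rewrite ltr_norml; move: yx hg;
    rewrite le_eqVlt => /negPf ->/=; lra.
- split; first by apply: (br_valid brW (Wj (d / 2) _)); lra.
  by rewrite -k20; apply: arm_branch_to => //; exact: k2c.
- split; first by apply: (br_valid brW (Wi (d / 2) _)); lra.
  by rewrite -k10; apply: arm_branch_to => //; exact: k1c.
apply/eqP => ij. subst j.
have [u u0 ku] := ki _ ltr01; have [v v0 kv] := kj _ ltr01.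
have Pi : P i by apply: (br_valid brW (Wi (d / 2) _)); lra.
pose m := Num.min r (Num.min u v).
have m0 : 0 < m by rewrite !lt_min u0 v0 (br_radius brW).
have mr : m <= r by rewrite ge_min lexx.
have mu : m <= u by rewrite !ge_min lexx orbT.
have mv : m <= v by rewrite !ge_min lexx !orbT.
have [|y Wy ym] := br_onto brW (h := m / 2) Pi; first by lra.
have [||s /andP[s0 _] ks] := ku y => //; first by lra.
have [||t /andP[t0 _] kt] := kv y => //; first by lra.
have : h x + s = h x - t by apply: kinj; rewrite -/(k1 s) -/(k2 t) ks kt.
lra.
Qed.


(** Compactness gives a cluster point x of the arc as tau tends to 0. It is a
    zero of tau, and near x the points of the arc can only lie in the two
    branches that end at x, so the arc is one of these. *)
Lemma branch_limit (i : I) : P i -> exists2 x, tau x = 0 & branch_to i x.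
Proof.
move=> Pi; have r0 := br_radius brW.
have /choice[g gP] : forall h, exists y, 0 < h < r -> W i y /\ tau y = h.
  have [y0 _ _] : exists2 y, W i y & tau y = r / 2 by apply: (br_onto brW Pi);
    lra.
  move=> h; have [hr|hr] := pselect (0 < h < r); last by exists y0.
  by have [y Wy ty] := br_onto brW Pi hr; exists y.
have small d : 0 < d -> \forall h \near (0 : R)^'+, 0 < h < Num.min r d.
  move=> d0; have m0 : 0 < Num.min r d by rewrite lt_min r0 d0.
  near=> h; apply/andP; split; near: h; first exact: nbhs_right_gt.
  exact: nbhs_right_lt.
have [cM _ _] := manM.
have [x [_ xg]] := cM (g @ (0 : R)^'+) _ filterT.
have x0 : tau x = 0.
  apply/eqP; rewrite eq_le (br_ge0 brW) andbT leNgt; apply/negP => tx.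
  have tx2 : 0 < tau x / 2 by lra.
  have [|| y [/= [h hm yh] yx]] :=
    xg (g @` [set h | 0 < h < Num.min r (tau x / 2)])
      (tau @^-1` `]tau x / 2, +oo[%classic).
  - have := small _ tx2; apply: filterS => h hm; by exists h.
  - have : \forall y \near x, tau x / 2 < tau y.
      have tc : tau y @[y --> x] --> tau x by exact: (br_cont brW).
      by apply: (cvgr_gt _ tc); lra.
    by apply: filterS => y /=; rewrite in_itv /= andbT.
  move: yx; rewrite -yh in_itv /= andbT; move: hm; rewrite lt_min.
  by move=> /andP[h0 /andP[hr hx]]; have [|_ ->] := gP h; lra.
exists x => //; have [j [k [_ [_ jx] [_ kx] xjk]]] := two_branches x0.
have [| y [/= [h hm yh] yx]] := xg (g @` [set h | 0 < h < Num.min r 1]) _ _ xjk.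
  have := small _ ltr01; apply: filterS => h hm; by exists h.
move: hm; rewrite lt_min => /andP[h0 /andP[hr _]].
have [|Wi th] := gP h; first by rewrite h0.
rewrite -{y}yh in yx.
case: yx => [yx|[Wj|Wk]].
- by exfalso; move: th; rewrite yx x0; lra.
- by rewrite (br_disjoint brW Wi Wj).
- by rewrite (br_disjoint brW Wi Wk).
Unshelve. all: by end_near. Qed.

Lemma branch_near (i : I) (x : M) (N : set M) (d : R) :
  P i -> branch_to i x -> nbhs x N -> 0 < d ->
  exists y, [/\ W i y, N y & tau y < d].
Proof.
move=> Pi ix xN d0; have [u u0 uN] := ix _ xN.
pose m := Num.min r (Num.min u d).
have m0 : 0 < m by rewrite !lt_min u0 d0 (br_radius brW).
have mr : m <= r by rewrite ge_min lexx.
have mu : m <= u by rewrite !ge_min lexx orbT.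
have md : m <= d by rewrite !ge_min lexx !orbT.
have [|y Wy ym] := br_onto brW (h := m / 2) Pi; first by lra.
by exists y; split=> //; [apply: uN => //; lra|lra].
Qed.

Lemma branch_to_unique (i : I) (x y : M) :
  P i -> branch_to i x -> branch_to i y -> x = y.
Proof.
move=> Pi ix iy; have [_ hM _] := manM; apply: hM => A B xA yB.
have [u u0 uB] := iy _ yB.
by have [z [Wz Az zu]] := branch_near Pi ix xA u0; exists z; split=> //;
  exact: uB.
Qed.

Section Height.
Variables (H : M -> R) (c : R) (up : pred I).
Hypothesis H0 : forall x, tau x = 0 -> H x = c.

Definition graded_height : Prop := forall i, P i -> exists2 d, 0 < d &
  forall y, W i y -> tau y < d -> if up i then c < H y else H y < c.

Hypothesis Hup : graded_height.

Lemma local_max_branches (x : M) (i j : I) : P i -> P j ->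
  tau x = 0 -> branch_to i x -> branch_to j x ->
  (\forall y \near x, y = x \/ W i y \/ W j y) ->
  (\forall y \near x, H y <= H x) <-> ~~ up i /\ ~~ up j.
Proof.
move=> Pi Pj x0 ix jx xij; split.
  move=> xmax; have notup k : P k -> branch_to k x -> ~~ up k.
    move=> Pk kx; apply/negP => upk.
    have [d d0] := Hup Pk; rewrite upk => kH.
    have [y [Wy yx yd]] := branch_near Pk kx xmax d0.
    by have := kH _ Wy yd; rewrite ltNge -(H0 x0) yx.
  by split; exact: notup.
move=> [upi upj]; have [d d0] := Hup Pi; have [e e0] := Hup Pj.
rewrite (negPf upi) (negPf upj) => jH iH.
have tx a : 0 < a -> \forall y \near x, tau y < a.
  have tc : tau y @[y --> x] --> tau x by exact: (br_cont brW).
  by move=> a0; apply: (cvgr_lt _ tc); rewrite x0.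
apply: filterS3 xij (tx _ d0) (tx _ e0) => y yij yd ye; rewrite (H0 x0).
case: yij => [->|[Wy|Wy]]; first by rewrite H0.
- exact/ltW/iH.
- exact/ltW/jH.
Qed.

End Height.

(** Local minima are treated as local maxima of the opposite height. *)
Lemma graded_heightN (H : M -> R) (c : R) (up : pred I) :
  graded_height H c up ->
  graded_height (fun x => - H x) (- c) (fun i => ~~ up i).
Proof.
move=> Hup i /Hup[d d0 dH]; exists d => // y Wy yd.
by have := dH y Wy yd; case: (up i); rewrite /= ltrN2.
Qed.

Lemma card_fset_set_sub (X A : set M) (a : pred M) : finite_set X ->
  (forall x, A x <-> X x /\ a x) ->
  #|` fset_set A |%fset = (\sum_(x <- fset_set X) a x)%N.
Proof.
move=> finX AX; have finA : finite_set A.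
  by apply: sub_finite_set finX => x /AX[].
rewrite -big_mkcond/= sum1_count -size_filter; apply: perm_size.
apply: uniq_perm => [||x]; [exact: fset_uniq|exact/filter_uniq/fset_uniq|].
rewrite mem_filter !in_fset_set//; apply/idP/idP.
  by rewrite inE => /AX[Xx ax]; rewrite ax; apply/mem_set.
by move=> /andP[ax /set_mem Xx]; apply/mem_set/AX.
Qed.

(** A zero x of tau with end branches i and j contributes
    2 * ([neither goes up] - [both go up]) to the left-hand side, which is the
    sum of the signs of i and j; every branch ends at exactly one zero. *)
Lemma signed_extrema_count (H : M -> R) (c : R) (up : pred I) :
  (forall x, tau x = 0 -> H x = c) -> graded_height H c up ->
  let maxima := [set x | tau x = 0 /\ \forall y \near x, H y <= H x] in
  let minima := [set x | tau x = 0 /\ \forall y \near x, H x <= H y] in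
  2 * ((#|` fset_set maxima |%fset)%:R - (#|` fset_set minima |%fset)%:R) =
  \sum_(i | P i) (if up i then -1 else 1) :> R.
Proof.
move=> H0 Hup maxima minima; set X := tau @^-1` [set 0].
have finX : finite_set X by exact: (br_finite brW).
have cardE (A : M -> Prop) :
    #|` fset_set [set x | tau x = 0 /\ A x] |%fset
    = (\sum_(x <- fset_set X) `[< A x >])%N.
  by apply: card_fset_set_sub => // x; split=> -[? /asboolP ?].
rewrite /maxima /minima !cardE {cardE maxima minima}.
rewrite !natr_sum -sumrB mulr_sumr.
pose eps i : R := if up i then -1 else 1.
transitivity
  (\sum_(x <- fset_set X) \sum_(i | P i && `[< branch_to i x >]) eps i).
  apply: eq_big_seq => x; rewrite in_fset_set// => /set_mem x0.
  have [i [j [ij [Pi ix] [Pj jx] xij]]] := two_branches x0.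
  rewrite (bigD1 i) ?Pi ?(asboolT ix)//= (bigD1 j) /=; last first.
    by rewrite Pj (asboolT jx) eq_sym.
  rewrite big1 => [|k /andP[/andP[/andP[Pk /asboolP kx] ki] kj]]; last first.
    have [y [Wk [yx|[Wy|Wy]] _]] := branch_near Pk kx xij ltr01.
    - by move: (br_gt0 brW Wk); rewrite yx x0 ltxx.
    - by rewrite (br_disjoint brW Wk Wy) eqxx in ki.
    - by rewrite (br_disjoint brW Wk Wy) eqxx in kj.
  have /asbool_equiv_eq -> := local_max_branches H0 Hup Pi Pj x0 ix jx xij.
  have HN0 y : tau y = 0 -> - H y = - c by move=> /H0 ->.
  have /asbool_equiv_eq -> : (\forall y \near x, H x <= H y) <-> up i /\ up j.
    have := local_max_branches HN0 (graded_heightN Hup) Pi Pj x0 ix jx xij.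
    rewrite !negbK => <-.
    by split; apply: filterS => y; rewrite lerN2.
  rewrite !asbool_and !asboolb /eps.
  by case: (up i); case: (up j) => /=; lra.
rewrite (exchange_big_dep P)/=; last by move=> x i _ /andP[].
apply: eq_bigr => i Pi; have [x x0 ix] := branch_limit Pi.
rewrite big_mkcond/= (bigD1_seq x) ?fset_uniq//=; last first.
  by rewrite in_fset_set//; apply/mem_set.
rewrite Pi (asboolT ix)/= big1 ?addr0// => y yx.
case: asboolP => // iy; move/eqP: yx; case; exact: (branch_to_unique Pi iy ix).
Qed.

End Branching.

(** * Integrals off a null set, and great circles *)

Section NullSets.
Import HBNNSimple.

(** The integral of a nonnegative function is a supremum over the simple
    functions below it, and cutting a simple function below f by the indicator
    of the complement of N keeps its integral and brings it below g. This
    compares arbitrary nonnegative functions, such as those built from nlm. *)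
Lemma ge0_integral_le_off_null d (T : measurableType d) (R : realType)
    (mu : {measure set T -> \bar R}) (D N : set T) (f g : T -> \bar R) :
  (forall x, D x -> (0 <= f x)%E) -> (forall x, D x -> (0 <= g x)%E) ->
  measurable N -> mu N = 0%E -> (forall x, D x -> ~ N x -> f x = g x) ->
  (\int[mu]_(x in D) f x <= \int[mu]_(x in D) g x)%E.
Proof.
move=> f0 g0 mN N0 fg; rewrite !ge0_integralE//.
apply: ge_ereal_sup => _ /= [h hf <-].
pose h' := mul_nnsfun h (indic_nnsfun R (measurableC mN)).
have -> : sintegral mu h = sintegral mu h'.
  have := @integral_nnsfun _ T R mu setT measurableT h.
  have := @integral_nnsfun _ T R mu setT measurableT h'.
  rewrite !patch_setT => <- <-.
  apply: ge0_ae_eq_integral => //.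
  - by apply/measurable_EFinP.
  - by apply/measurable_EFinP.
  - by move=> x _; rewrite lee_fin; exact: fun_ge0.
  - by move=> x _; rewrite lee_fin; exact: fun_ge0.
  exists N; split=> // x /= hx; apply: contrapT => Nx; apply: hx => _.
  by rewrite /= mindicE mem_set// mulr1.
apply: ereal_sup_ubound; exists h' => //= x; rewrite mindicE.
have [Nx|Nx] := pselect (N x).
  rewrite memNset; last by move=> /(_ Nx).
  rewrite mulr0 patchE; case: ifPn => // /set_mem; exact: g0.
rewrite mem_set// mulr1 (le_trans (hf x))// !patchE;
  case: ifPn => // /set_mem Dx.
by rewrite fg.
Qed.

Lemma ge0_eq_integral_off_null d (T : measurableType d) (R : realType)
    (mu : {measure set T -> \bar R}) (D N : set T) (f g : T -> \bar R) :
  (forall x, D x -> (0 <= f x)%E) -> (forall x, D x -> (0 <= g x)%E) ->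
  measurable N -> mu N = 0%E -> (forall x, D x -> ~ N x -> f x = g x) ->
  (\int[mu]_(x in D) f x = \int[mu]_(x in D) g x)%E.
Proof.
move=> f0 g0 mN N0 fg; apply/eqP; rewrite eq_le; apply/andP; split.
  exact: (ge0_integral_le_off_null f0 g0 mN N0).
apply: (ge0_integral_le_off_null g0 f0 mN N0) => x Dx Nx.
by rewrite fg.
Qed.

End NullSets.

Section SphereMeasure.
Variable R : realType.
Local Notation lam := (@lebesgue_measure R).
Implicit Types T : 'rV[R]_3.

Lemma dotv_sph (th ph : R) T : dotv (sph th ph) T =
  sin th * cos ph * T 0 0 + sin th * sin ph * T 0 1 + cos th * T 0 2.
Proof.
rewrite /dotv !big_ord_recl big_ord0 addr0 !mxE /= addrA.
by congr (_ * T 0 _ + _ * T 0 _ + _ * T 0 _); apply: val_inj.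
Qed.

Lemma finite_subsingleton (U : Type) (A : set U) :
  (forall x y, A x -> A y -> x = y) -> finite_set A.
Proof.
move=> A1; have [[x Ax]|/set0P/negP] := pselect (A !=set0).
  by rewrite (_ : A = [set x]) //; apply/seteqP; split => [y Ay|y ->] //;
    exact: A1.
by rewrite negbK => /eqP ->.
Qed.

(** Two zeros x and y satisfy sin (y - x) = 0, because (a, b) is a nonzero
    vector orthogonal to both (cos x, sin x) and (cos y, sin y). So each of
    [0, pi[ and [pi, 2 pi[ contains at most one zero. *)
Lemma finite_sinusoid_zeros (a b : R) : (a != 0) || (b != 0) ->
  finite_set [set x | 0 <= x <= 2 * pi /\ a * cos x + b * sin x = 0].
Proof.
move=> ab0; set Z := [set x | _].
have Zsin x y : Z x -> Z y -> sin (y - x) = 0.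
  move=> [_ zx] [_ zy]; rewrite sinB.
  have [a0|b0] := orP ab0.
    apply: (mulfI a0); rewrite mulr0.
    transitivity (sin y * (a * cos x + b * sin x)
                  - sin x * (a * cos y + b * sin y)).
      by ring.
    by rewrite zx zy !mulr0 subr0.
  apply: (mulfI b0); rewrite mulr0.
  transitivity (cos x * (a * cos y + b * sin y)
                - cos y * (a * cos x + b * sin x)).
    by ring.
  by rewrite zx zy !mulr0 subr0.
have Zpi x y : Z x -> Z y -> x < y -> y - x < pi -> False.
  move=> Zx Zy xy yx; have := Zsin _ _ Zx Zy.
  by apply/eqP; rewrite gt_eqF// sin_gt0_pi//; lra.
have Zdist c x y : Z x -> Z y -> c <= x < c + pi -> c <= y < c + pi -> x = y.
  move=> Zx Zy xc yc; have [xy|yx|//] := ltgtP x y.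
  - by exfalso; apply: (Zpi x y) => //; lra.
  - by exfalso; apply: (Zpi y x) => //; lra.
apply: (@sub_finite_set _ _ ((Z `&` [set x | 0 <= x < 0 + pi]) `|`
    (Z `&` [set x | pi <= x < pi + pi]) `|` [set 2 * pi])).
  move=> x Zx; have [/andP[x0 x2] _] := Zx.
  have [xpi|xpi] := ltP x pi; first by left; left; split=> //=; lra.
  have [xpi2|xpi2] := ltP x (2 * pi); first by left; right; split=> //=; lra.
  by right => /=; lra.
rewrite !finite_setU; split; last exact: finite_set1.
by split; apply: finite_subsingleton => x y [Zx cx] [Zy cy];
  exact: Zdist Zx Zy cx cy.
Qed.

Lemma measurable_dotv_sph T :
  measurable_fun [set: measurableTypeR R * measurableTypeR R]
    (fun x => dotv (sph x.1 x.2) T).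
Proof.
rewrite (_ : (fun _ => _) = fun x => sin x.1 * cos x.2 * T 0 0 +
    sin x.1 * sin x.2 * T 0 1 + cos x.1 * T 0 2); last first.
  by apply/funext => x; rewrite dotv_sph.
have ms : measurable_fun setT (@sin R).
  by apply: continuous_measurable_fun; exact: continuous_sin.
have mc : measurable_fun setT (@cos R).
  by apply: continuous_measurable_fun; exact: continuous_cos.
have mfst := @measurable_fst _ _ (measurableTypeR R) (measurableTypeR R).
have msnd := @measurable_snd _ _ (measurableTypeR R) (measurableTypeR R).
have ms1 := measurableT_comp ms mfst; have mc1 := measurableT_comp mc mfst.
have ms2 := measurableT_comp ms msnd; have mc2 := measurableT_comp mc msnd.
have mcst c := @measurable_cst _ _ (measurableTypeR R * measurableTypeR R)%type
  (measurableTypeR R) setT c.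
exact: (measurable_funD (measurable_funD
  (measurable_funM (measurable_funM ms1 mc2) (mcst _))
  (measurable_funM (measurable_funM ms1 ms2) (mcst _)))
  (measurable_funM mc1 (mcst _))).
Qed.

(** Integration over the second variable first, hence the passage to the
    other product measure. *)
Lemma product_measure_countable_sections
    (A : set (measurableTypeR R * measurableTypeR R)) (C : set R) :
  measurable A -> countable C ->
  (forall y, ~ C y -> countable (ysection A y)) ->
  (lam \x lam)%E A = 0%E.
Proof.
move=> mA cC cA.
rewrite (@product_measure_unique _ _ _ _ R lam lam
  (product_measure2 lam lam))//; last first.
  by move=> *; exact: product_measure2E.
transitivity (\int[lam]_(y in setT) cst 0%E y)%E; last exact: integral0.
rewrite /product_measure2.
apply: (@ge0_eq_integral_off_null _ (measurableTypeR R) R lam setT C) => //.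
- by apply: countable_measurable => // t; exact: measurable_set1.
- exact: countable_lebesgue_measure0.
- by move=> y _ /cA /countable_lebesgue_measure0 /=.
Qed.

Definition polar_rectangle : set (measurableTypeR R * measurableTypeR R) :=
  `[0%R, pi] `*` `[0%R, (2 * pi)%R].

Lemma measurable_polar_rectangle : measurable polar_rectangle.
Proof. by apply: measurableX; exact: measurable_itv. Qed.

Definition great_circle T : set (measurableTypeR R * measurableTypeR R) :=
  polar_rectangle `&` [set x | dotv (sph x.1 x.2) T = 0].

Lemma measurable_great_circle T : measurable (great_circle T).
Proof.
apply: measurableI; first exact: measurable_polar_rectangle.
rewrite -[X in measurable X]setTI.
exact: (measurable_dotv_sph T measurableT (measurable_set1 0)).
Qed.

(** At a fixed longitude y the equation in the colatitude x is
    T 0 2 * cos x + a * sin x = 0 with a = T 0 0 * cos y + T 0 1 * sin y. It has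
    finitely many solutions unless T 0 2 and a vanish, and if T 0 2 = 0 then a
    vanishes for finitely many y only. Fixing the colatitude instead would lead
    to inhomogeneous equations. *)
Lemma great_circle_null T : T != 0 -> (lam \x lam)%E (great_circle T) = 0%E.
Proof.
move=> T0; have mT := measurable_great_circle T.
have [T2|T2] := eqVneq (T 0 2) 0.
  have T01 : (T 0 0 != 0) || (T 0 1 != 0).
    apply: contraNT T0; rewrite negb_or !negbK => /andP[/eqP T00 /eqP T01].
    apply/eqP/matrixP => i j; rewrite mxE (ord1 i).
    case: j => -[|[|[|//]]] p.
    - by rewrite -[RHS]T00; congr (T 0 _); apply: val_inj.
    - by rewrite -[RHS]T01; congr (T 0 _); apply: val_inj.
    - by rewrite -[RHS]T2; congr (T 0 _); apply: val_inj.
  have cT := finite_set_countable (finite_sinusoid_zeros T01).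
  apply: (product_measure_countable_sections mT cT).
  move=> y /= yT; have [y2|y2] := pselect (0 <= y <= 2 * pi); last first.
    rewrite (_ : ysection _ _ = set0)//; apply/seteqP; split => // x.
    by move=> /set_mem[[_ /=]]; rewrite in_itv.
  set a := T 0 0 * cos y + T 0 1 * sin y.
  have a0 : a != 0 by apply/eqP => a0; apply: yT.
  apply: finite_set_countable.
  have : finite_set [set x | 0 <= x <= 2 * pi /\ 0 * cos x + a * sin x = 0].
    by apply: finite_sinusoid_zeros; rewrite a0 orbT.
  apply: sub_finite_set => x /set_mem[[/= + _]].
  rewrite in_itv /= dotv_sph => /andP[x0 xpi]; rewrite T2 mulr0 addr0 => xT.
  split; first by lra.
  by rewrite -[RHS]xT /a; ring.
apply: (product_measure_countable_sections mT (countable0 _)) => y _.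
apply: finite_set_countable.
  have : finite_set [set x | 0 <= x <= 2 * pi /\
    T 0 2 * cos x + (T 0 0 * cos y + T 0 1 * sin y) * sin x = 0].
  by apply: finite_sinusoid_zeros; rewrite T2.
apply: sub_finite_set => x /set_mem[[/= + _]].
rewrite in_itv /= dotv_sph => /andP[x0 xpi] xT.
split; first by lra.
by rewrite -[RHS]xT; ring.
Qed.

End SphereMeasure.

(** * One-sided tangents of piecewise C^2 arcs *)

Section DotProduct.
Variable R : realType.
Implicit Types e u v : 'rV[R]_3.

Lemma dotvBr e u v : dotv e (u - v) = dotv e u - dotv e v.
Proof. by rewrite /dotv -sumrB; apply: eq_bigr => i _; rewrite !mxE mulrBr. Qed.

Lemma dotvZr e (a : R) u : dotv e (a *: u) = a * dotv e u.
Proof. by rewrite /dotv mulr_sumr; apply: eq_bigr => i _;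
  rewrite !mxE mulrCA. Qed.

Lemma enorm_gt0 u : u != 0 -> 0 < enorm u.
Proof.
move=> u0; rewrite sqrtr_gt0 lt0r sumr_ge0 ?andbT => [|i _];
  last exact: sqr_ge0.
apply: contraNN u0 => /eqP uu; apply/eqP/rowP => i; rewrite mxE.
have /(_ i isT)/eqP := psumr_eq0P (fun i _ => sqr_ge0 (u 0 i)) uu.
by rewrite sqrf_eq0 => /eqP.
Qed.

Lemma cvg_dotv (U : Type) (F : set_system U) {FF : Filter F} e
    (f : U -> 'rV[R]_3) u :
  f @ F --> u -> dotv e (f h) @[h --> F] --> dotv e u.
Proof.
move=> fu; apply: cvg_big => [|i _]; first exact: add_continuous.
apply: cvgM; first exact: cvg_cst.
exact: (cvg_comp _ (fun v : 'rV[R]_3 => v 0 i) fu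
  (@coord_continuous _ _ _ 0 i u)).
Qed.

End DotProduct.

Section Tangents.
Variable R : realType.
Implicit Types (c : R -> 'rV[R]_3) (e : 'rV[R]_3).

Lemma predicate_drop (p : pred R) (a : R) (l : seq R) :
  p a -> ~~ p (last a l) ->
  exists i, [/\ (i < size l)%N, p (a :: l)`_i & ~~ p (a :: l)`_i.+1].
Proof.
elim: l a => [a pa|x l IH a pa npl] /=; first by rewrite pa.
have [px|npx] := boolP (p x); last by exists 0%N.
by have [i [il pi npi]] := IH x px npl; exists i.+1.
Qed.

(** The parameter t has room inside [0, 1] on the side b: to its left if b, to
    its right otherwise. *)
Definition side_ok (b : bool) (t : R) : bool :=
  if b then 0 < t <= 1 else 0 <= t < 1.

Definition quotient c (b : bool) (t h : R) : 'rV[R]_3 :=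
  h^-1 *: (c (t + (-1) ^+ b * h) - c t).

Lemma scale_to_punctured (a : R) : a != 0 -> a * h @[h --> 0^'+] --> 0^'.
Proof.
move=> a0 A /= [d /= d0 dA]; exists (d / `|a|) => /=.
  by rewrite divr_gt0// normr_gt0.
move=> h /=; rewrite sub0r normrN => hd h0; apply: dA.
  by rewrite /= sub0r normrN normrM mulrC -ltr_pdivlMr// normr_gt0.
by rewrite mulf_neq0// gt_eqF.
Qed.

(** The piece that contains t and a one-sided neighborhood of t on the side b is
    the one where the predicate q, that the endpoint lies before t, changes from
    true to false. There the arc coincides with a differentiable map of the
    line, whose derivative gives the limit up to the sign (-1)^b. *)
Lemma piecewise_C2_quotient c b t : piecewise_C2 c -> side_ok b t ->
  exists2 D : 'rV[R]_3, D != 0 & quotient c b t @ 0^'+ --> D.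
Proof.
move=> [s [_ creg]] tb.
pose q x := if b then x < t else x <= t.
have [||i [il qi nqi]] := @predicate_drop q 0 (rcons s 1).
- by move: tb; rewrite /q /side_ok; case: (b) => /andP[].
- by move: tb; rewrite last_rcons /q /side_ok; case: (b) => /andP[];
  rewrite -?leNgt -?ltNge.
rewrite size_rcons ltnS in il.
have [c1 [dc1 _ _ cc1 c1n0]] := creg i il.
set u := nth _ _ i in qi cc1 c1n0; set v := nth _ _ i.+1 in nqi cc1 c1n0.
have tuv : t \in `[u, v].
  by move: qi nqi; rewrite in_itv/= /q; case: (b);
    rewrite -?leNgt -?ltNge => ? ?; lra.
have huv : \forall h \near (0 : R)^'+, t + (-1) ^+ b * h \in `[u, v].
  have [d d0 dP] : exists2 d, 0 < d &
      forall h, 0 < h < d -> t + (-1) ^+ b * h \in `[u, v].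
    move: qi nqi; rewrite /q; case: (b); rewrite -?leNgt -?ltNge => ut tv.
      by exists (t - u); [lra|move=> h hd; rewrite in_itv/= expr1; lra].
    by exists (v - t); [lra|move=> h hd; rewrite in_itv/= expr0; lra].
  near=> h; apply: dP; apply/andP; split; near: h; first exact: nbhs_right_gt.
  exact: nbhs_right_lt.
exists ((-1) ^+ b *: derive1 c1 t).
  by rewrite scaler_eq0 signr_eq0 /= c1n0.
have c1D : (fun h => h^-1 *: (c1 (h + t) - c1 t)) @ 0^' --> derive1 c1 t.
  have E : (fun h : R => h^-1 *: (c1 (h *: 1 + t) - c1 t)) =
      fun h => h^-1 *: (c1 (h + t) - c1 t).
    by apply/funext => h; rewrite [h *: 1]mulr1.
  by have := dc1 t; rewrite /derivable E.
have : (fun h => (-1) ^+ b *: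
      (((-1) ^+ b * h)^-1 *: (c1 ((-1) ^+ b * h + t) - c1 t)))
    @ 0^'+ --> (-1) ^+ b *: derive1 c1 t.
  apply: cvgZr; apply: (cvg_comp _ _ _ c1D).
  by apply: scale_to_punctured; rewrite signr_eq0.
apply: cvg_trans; apply: near_eq_cvg; near=> h.
rewrite /quotient [c (t + _)]cc1 ?[c t]cc1//; last by near: h.
by rewrite scalerA invfM mulrA invr_sign -expr2 sqrr_sign mul1r [_ + t]addrC.
Unshelve. all: by end_near. Qed.

(** The tangent is a positive multiple of the limit D of the difference
    quotients, and dotv e of the quotient tends to dotv e D, so it has the sign
    of dotv e D for small h. *)
Lemma unit_tangentP c b t : piecewise_C2 c -> side_ok b t ->
  unit_tangent c b t != 0 /\
  forall e, dotv e (unit_tangent c b t) != 0 -> exists2 d, 0 < d &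
    forall h, 0 < h < d -> if 0 < dotv e (unit_tangent c b t)
      then dotv e (c t) < dotv e (c (t + (-1) ^+ b * h))
      else dotv e (c (t + (-1) ^+ b * h)) < dotv e (c t).
Proof.
move=> cP tb; have [D D0 cD] := piecewise_C2_quotient cP tb.
have -> : unit_tangent c b t = (enorm D)^-1 *: D.
  by rewrite /unit_tangent (cvg_lim _ cD)//; exact: norm_hausdorff.
have nD : 0 < (enorm D)^-1 by rewrite invr_gt0 enorm_gt0.
split; first by rewrite scaler_eq0 (gt_eqF nD).
move=> e; rewrite dotvZr pmulr_rgt0// mulf_eq0 (gt_eqF nD) /= => eD.
have eQ : dotv e (quotient c b t h) @[h --> 0^'+] --> dotv e D.
  exact: cvg_dotv.
have : \forall h \near (0 : R)^'+,
    if 0 < dotv e D then 0 < dotv e (quotient c b t h)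
    else dotv e (quotient c b t h) < 0.
  case: ltP => eD0 /=; first by apply: (cvgr_gt _ eQ).
  by apply: (cvgr_lt _ eQ); rewrite lt_neqAle eD.
move=> [d /= d0 dP]; exists d => // h /andP[h0 hd].
have := dP h; rewrite /= sub0r normrN gtr0_norm// => /(_ hd h0).
rewrite /quotient dotvZr dotvBr; case: ifP => _.
  by rewrite pmulr_rgt0 ?invr_gt0// subr_gt0.
by rewrite pmulr_rlt0 ?invr_gt0// subr_lt0.
Qed.

End Tangents.

(** * The star of a point of the graph *)

Lemma edge_point_in (R : realType) (G : pwC2graph R) (e : edge G) (s : R)
  (s01 : 0 < s < 1) : edge_point e s = GEdge e (exist _ s s01).
Proof. by rewrite /edge_point insubT. Qed.

Lemma edge_point_out (R : realType) (G : pwC2graph R) (e : edge G) (s : R) :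
  ~~ (0 < s < 1) -> edge_point e s = GVert (ends e (1 <= s)).
Proof. by move=> s01; rewrite /edge_point insubN. Qed.

Lemma open_gpoint (R : realType) (G : pwC2graph R) (O : set (gpoint G)) :
  open O = forall e : edge G, open (edge_point e @^-1` O).
Proof. by []. Qed.

Section Star.
Variables (R : realType) (G : pwC2graph R) (q : gpoint G).
Implicit Types (h : edge G * bool) (e : edge G) (p : gpoint G).

(** The edge ends at q and the interior points of an edge are treated alike: a
    branch (e, b) is the arc issued from the parameter start (e, b) of e, toward
    decreasing parameters if b and increasing ones otherwise. For q inside e
    both (e, true) and (e, false) are branches, and they have the same start. *)
Definition branch h : bool :=
  match q with GVert v => ends h.1 h.2 == v | GEdge e _ => h.1 == e end.

Definition start h : R :=
  match q with GVert _ => h.2%:R | GEdge _ t => val t end.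

(** At this radius the arcs stay inside their edges and, at a vertex, the two
    ends of a loop stay apart. *)
Definition radius : R :=
  match q with GVert _ => 2^-1 | GEdge _ t => Num.min (val t) (1 - val t) end.

Lemma radius_gt0 : 0 < radius.
Proof.
rewrite /radius; case: q => [v|e [t /= /andP[t0 t1]]];
  first by rewrite invr_gt0.
by rewrite lt_min t0 subr_gt0.
Qed.

Lemma start_side_ok h : side_ok h.2 (start h).
Proof.
rewrite /start /side_ok; case: q => [v|e [t /= /andP[t0 t1]]].
  by case: h.2; rewrite ?ltr01 ?lexx.
by case: h.2; rewrite ?t0 ?t1 ltW.
Qed.

Lemma branch_interior h (s : R) : 0 < s < radius ->
  0 < start h + (-1) ^+ h.2 * s < 1.
Proof.
rewrite /start /radius; case: q => [v|e [t /= /andP[t0 t1]]].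
  by case: h.2 => /= ?; rewrite ?expr1 ?expr0; lra.
by rewrite lt_min; case: h.2 => /=; rewrite ?expr1 ?expr0; lra.
Qed.

Lemma edge_arc_start h : branch h -> edge_arc h.1 (start h) = point_map q.
Proof.
rewrite /branch /start; case: q => [v|e [t t01]] /= /eqP <- //.
by case: h.2; [exact: arc_end|exact: arc_start].
Qed.

Lemma sum_tangents (F : 'rV[R]_3 -> R) :
  \sum_(T <- tangents q) F T =
  \sum_(h | branch h) F (unit_tangent (edge_arc h.1) h.2 (start h)).
Proof.
rewrite /branch /start; case: q => [v|e [t t01]] /=.
  by rewrite big_map big_filter big_enum_cond.
transitivity (\sum_(e' | e' == e) \sum_(b : bool)
  F (unit_tangent (edge_arc e') b t)).
  by rewrite big_pred1_eq big_bool !big_cons big_nil addr0.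
by rewrite pair_big; apply: eq_bigl => h; rewrite andbT.
Qed.

(** Distances are truncated at the radius, which makes the distance below
    continuous on the whole graph. *)
Definition end_dist h (s : R) : R :=
  if branch h then Num.min radius `|s - start h| else radius.

Definition star_dist p : R :=
  match p with
  | GVert w => if p == q then 0 else radius
  | GEdge e s =>
      Num.min (end_dist (e, false) (val s)) (end_dist (e, true) (val s))
  end.

(** The point of parameter s outside of [0, 1] is the nearest end vertex, that
    is, the point of the clamped parameter. The formula shows continuity along
    each closed edge, which is continuity for the CW topology. *)
Lemma star_dist_edge_point e (s : R) (s' := Num.max 0 (Num.min s 1)) :
  star_dist (edge_point e s) =
  Num.min (end_dist (e, false) s') (end_dist (e, true) s').
Proof.
have [s01|s01] := boolP (0 < s < 1).
  have -> : s' = s by case/andP: s01 => s0 s1; rewrite /s' min_l ?max_r// ltW.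
  by rewrite edge_point_in.
have r0 := radius_gt0.
have s'E : s' = (1 <= s)%R%:R.
  rewrite /s'; move: s01; rewrite negb_and -!leNgt => s01.
  have [s1|s1] := leP 1 s; first by rewrite max_r.
  by rewrite max_l//; case/orP: s01 => //; lra.
rewrite edge_point_out//= {}s'E /end_dist; move: r0.
set b := (1 <= s); rewrite /branch /start /radius.
case: q => [v|e' [t t01]] /= r0; last have /andP[t0 t1] := t01.
  rewrite (_ : (GVert _ == GVert v) = (ends e b == v)); last first.
    by apply/eqP/eqP => [[]//|->].
  rewrite {}/b; case: (1 <= s) => /=;
    rewrite ?subrr ?subr0 ?sub0r ?normrN ?normr0 ?normr1.
    by case: ifP => _; case: ifP => _; rewrite ?minxx /Num.min; do ?case: ifP;
      lra.
  by case: ifP => _; case: ifP => _; rewrite ?minxx /Num.min; do ?case: ifP;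
    lra.
rewrite (_ : (GVert _ == GEdge e' _) = false); last by apply/negP => /eqP.
case: ifP => _; last by rewrite minxx.
rewrite minxx; apply/esym/min_l; rewrite ge_min; case: b => /=.
  by rewrite gtr0_norm ?lexx ?orbT//; lra.
by rewrite sub0r normrN gtr0_norm// lexx.
Qed.

Lemma continuous_star_dist : continuous star_dist.
Proof.
have minc (f g : R -> R) : continuous f -> continuous g ->
    continuous (fun s => Num.min (f s) (g s)).
  by move=> fc gc s; exact: (@continuous_min R R f g s (fc s) (gc s)).
have maxc (f g : R -> R) : continuous f -> continuous g ->
    continuous (fun s => Num.max (f s) (g s)).
  by move=> fc gc s; exact: (@continuous_max R R f g s (fc s) (gc s)).
have clampc : continuous (fun s : R => Num.max 0 (Num.min s 1)).
  by apply: maxc; [exact: cst_continuous|apply: minc => s];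
    [exact: cvg_id|exact: cvg_cst].
have endc h : continuous (end_dist h).
  rewrite /end_dist; case: (branch h); last exact: cst_continuous.
  apply: minc => s; first exact: cvg_cst.
  by apply: cvg_norm; apply: cvgB; [exact: cvg_id|exact: cvg_cst].
apply/continuousP => A oA; rewrite open_gpoint => e.
rewrite (_ : _ @^-1` _ = (fun s => Num.min
    (end_dist (e, false) (Num.max 0 (Num.min s 1)))
    (end_dist (e, true) (Num.max 0 (Num.min s 1)))) @^-1` A); last first.
  by apply/funext => s /=; rewrite star_dist_edge_point.
apply: open_comp => // s _; apply: minc => u;
  exact: (continuous_comp (clampc u) (endc _ _)).
Qed.

Lemma star_dist_ge0 p : 0 <= star_dist p.
Proof.
have r0 := ltW radius_gt0.
have endge h s : 0 <= end_dist h s.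
  by rewrite /end_dist; case: ifP => _ //; rewrite le_min r0 normr_ge0.
by case: p => [w|e s] /=; [case: ifP|rewrite le_min !endge].
Qed.

Definition on_branch h (s : R) : bool :=
  branch h && (0 < (-1) ^+ h.2 * (s - start h) < radius).

Lemma star_dist_on_branch e b (s : {s : R | 0 < s < 1}) :
  on_branch (e, b) (val s) ->
  star_dist (GEdge e s) = (-1) ^+ b * (val s - start (e, b)).
Proof.
move: s => [s /= /andP[s0 s1]]; rewrite /on_branch /= /end_dist => /andP[].
rewrite /branch /start /radius; case: q => [v|e' [t /= /andP[t0 t1]]] /=.
  case: b => /= ->; rewrite ?expr1 ?expr0 ?mul1r ?mulN1r; case: ifP => _ ?;
  rewrite ?(@ltr0_norm _ (s - 1)) ?subr0 ?(@gtr0_norm _ s)//; 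
    rewrite /Num.min; do ?case: ifP; lra.
move=> ->; set r := Num.min t (1 - t) => sr; rewrite minxx.
case: b sr; rewrite ?expr1 ?expr0 ?mul1r ?mulN1r => /andP[? ?].
  by rewrite ltr0_norm ?min_r ?ltW //; lra.
by rewrite gtr0_norm ?min_r ?ltW //; lra.
Qed.

Lemma end_dist_lt h (s : R) : end_dist h s < radius ->
  branch h /\ end_dist h s = `|s - start h|.
Proof.
rewrite /end_dist; case: ifP => _; last by rewrite ltxx.
by rewrite gt_min ltxx /= => ss; rewrite min_r// ltW.
Qed.

Lemma star_dist_lt e (s : {s : R | 0 < s < 1}) :
  star_dist (GEdge e s) < radius ->
  exists b, branch (e, b) /\ star_dist (GEdge e s) = `|val s - start (e, b)|.
Proof.
rewrite /=; case: (leP (end_dist (e, false) (val s))) => _ /end_dist_lt[bh ->];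
  by [exists false|exists true].
Qed.

Lemma star_dist_cover p : 0 < star_dist p < radius ->
  exists e b (s : {s : R | 0 < s < 1}),
    p = GEdge e s /\ on_branch (e, b) (val s).
Proof.
case: p => [w /=|e s]; first by case: ifP; rewrite ltxx ?andbF.
move=> /andP[s0 sr]; have [b [eb sE]] := star_dist_lt sr.
rewrite {}sE in s0 sr; exists e.
suff [b' eb'] : exists b', on_branch (e, b') (val s) by exists b', s.
move: s eb s0 sr => [s /= /andP[s_gt0 s_lt1]];
  rewrite /on_branch /branch /start /radius.
case: q => [v|e' [t /= _]] /= eb.
  move=> _ sr; exists b; rewrite eb /=; move: sr; case: (b) => /=.
    by rewrite ltr0_norm ?subr_lt0// expr1 mulN1r; lra.
  by rewrite subr0 gtr0_norm// expr0 mul1r s_gt0.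
set r := Num.min t (1 - t); rewrite eb normr_gt0 => st sr.
exists (s < t); have [st'|st'] := ltP s t;
  rewrite /= ?expr1 ?expr0 ?mulN1r ?mul1r.
  by move: sr; rewrite ltr0_norm ?subr_lt0//; lra.
by move: sr; rewrite ger0_norm ?subr_ge0// => ->;
  rewrite andbT lt0r st subr_ge0.
Qed.

Lemma star_dist_eq0 p : star_dist p = 0 <-> p = q.
Proof.
have r0 := radius_gt0; case: p => [w|e s]; first rewrite /=.
  case: eqP => // wq; split=> // r00; by rewrite r00 ltxx in r0.
split=> [s0|]; last first.
  move=> qE; have [eb sb] :
      (forall b, branch (e, b)) /\ forall b, start (e, b) = val s.
    by rewrite /branch /start -qE; split.
  by rewrite /= /end_dist !eb !sb subrr normr0 minxx min_r// ltW.
have [|b] := @star_dist_lt e s; first by rewrite s0.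
rewrite {}s0 => -[eb /esym/normr0P]; rewrite subr_eq0 => /eqP.
move: eb; rewrite /branch /start; case: q => [v|e' t] /=.
  by case: s => s /= s01 _ sb; exfalso; move: s01; rewrite sb;
    case: b {sb} => /=; rewrite ?ltxx ?andbF.
by move=> /eqP -> /val_inj ->.
Qed.

Lemma on_branch_side_unique e b b' (s : R) : 0 < s < 1 ->
  on_branch (e, b) s -> on_branch (e, b') s -> b = b'.
Proof.
move=> s01; rewrite /on_branch /start /radius => /andP[_ +] /andP[_].
case: q => [v|e' [t /= _]] /=.
  by case: b; case: b' => //=; rewrite ?expr1 ?expr0; lra.
set r := Num.min t (1 - t).
by case: b; case: b' => //=; rewrite ?expr1 ?expr0; lra.
Qed.

Lemma on_branch_param h (x : R) : branch h -> 0 < x < radius ->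
  on_branch h (start h + (-1) ^+ h.2 * x).
Proof.
by rewrite /on_branch => -> xr;
  rewrite addrC addKr mulrA -expr2 sqrr_sign mul1r.
Qed.

End Star.

(** * Counting extrema over a point *)

Section Covering.
Variables (R : realType) (G : pwC2graph R) (q : gpoint G).
Variables (M : topologicalType) (f : M -> gpoint (double_graph G)).
Hypothesis parf : parameterization f.

Definition star_dist_over (y : M) : R := star_dist q (undouble (f y)).

Definition double_branch (i : (edge G * bool) * bool) : bool :=
  branch q (i.1.1, i.2).

Definition over_branch (i : (edge G * bool) * bool) : set M :=
  [set y | exists s : {s : R | 0 < s < 1},
    f y = @GEdge R (double_graph G) i.1 s /\ on_branch q (i.1.1, i.2) (val s)].

Lemma continuous_undouble : continuous (@undouble R G).
Proof.
apply/continuousP => A oA; rewrite open_gpoint => e; rewrite -comp_preimage.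
rewrite (_ : _ \o _ = edge_point e.1); first by move: oA; rewrite open_gpoint.
apply/funext => s /=; have [s01|s01] := boolP (0 < s < 1).
  by rewrite !edge_point_in.
by rewrite !edge_point_out.
Qed.

Lemma open_on_branch (i : (edge G * bool) * bool) :
  open [set p | exists s : {s : R | 0 < s < 1},
    p = @GEdge R (double_graph G) i.1 s /\ on_branch q (i.1.1, i.2) (val s)].
Proof.
rewrite open_gpoint => e.
have [->|ei] := eqVneq e i.1; last first.
  rewrite (_ : _ @^-1` _ = set0); first exact: open0.
  apply/seteqP; split=> // s [s' []]; have [s01|s01] := boolP (0 < s < 1).
    by rewrite edge_point_in => -[/eqP]; rewrite (negPf ei).
  by rewrite edge_point_out.
have sideE s : on_branch q (i.1.1, i.2) s -> 0 < s < 1.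
  move=> /andP[_ /(branch_interior (i.1.1, i.2))] /=.
  by rewrite mulrA -expr2 sqrr_sign mul1r addrC subrK.
rewrite (_ : _ @^-1` _ = [set s | on_branch q (i.1.1, i.2) s]); last first.
  apply/seteqP; split=> s /=.
    move=> [s' []]; have [s01|s01] := boolP (0 < s < 1).
      by rewrite edge_point_in => -[/(congr1 val) /= ->].
    by rewrite edge_point_out.
  by move=> si; exists (exist _ s (sideE s si)); split=> //;
    exact: edge_point_in.
have [qi|qi] := boolP (branch q (i.1.1, i.2)); last first.
  rewrite (_ : mkset _ = set0); first exact: open0.
  by apply/seteqP; split => s //=; rewrite /on_branch (negPf qi).
rewrite (_ : mkset _ = (fun s => (-1) ^+ i.2 * (s - start q (i.1.1, i.2))) @^-1`
   `]0, radius q[%classic); last first.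
  by apply/funext => s /=; rewrite in_itv /on_branch qi.
apply: open_comp; last exact: interval_open.
move=> s _; apply: cvgM; first exact: cvg_cst.
by apply: cvgB; [exact: cvg_id|exact: cvg_cst].
Qed.

Lemma star_dist_over_branch (i : (edge G * bool) * bool) y
    (s : {s : R | 0 < s < 1}) :
  f y = @GEdge R (double_graph G) i.1 s -> on_branch q (i.1.1, i.2) (val s) ->
  star_dist_over y = (-1) ^+ i.2 * (val s - start q (i.1.1, i.2)).
Proof.
by move=> fy si; rewrite /star_dist_over fy; exact: star_dist_on_branch.
Qed.

(** A parameterization is bijective over the open edges, so the arcs at q lift
    to branches in the manifold on which the distance is a coordinate. *)
Lemma branching_over :
  branching star_dist_over (radius q) double_branch over_branch.
Proof.
have [fc f1 ffin] := parf.
have GEdge_inj e s e' s' :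
    @GEdge R (double_graph G) e s = GEdge e' s' -> e = e' /\ s = s'.
  by move=> [].
split.
- move=> y.
  apply: (continuous_comp (f := f) (g := star_dist q \o @undouble R G)).
    exact: fc.
  apply: (continuous_comp (f := @undouble R G));
    first exact: continuous_undouble.
  exact: continuous_star_dist.
- by move=> y; exact: star_dist_ge0.
- rewrite (_ : _ @^-1` _ = [set y | undouble (f y) = q]); last first.
    by apply/seteqP; split => y /star_dist_eq0.
  case: (q) => [v|e t].
    rewrite (_ : mkset _ = f @^-1` [set @GVert R (double_graph G) v]);
      first exact: ffin.
    by apply/seteqP; split => y /=; [case: (f y) => // w [->]|move=> ->].
  have one c : finite_set [set y | f y = @GEdge R (double_graph G) (e, c) t].
    have [x [fx xu]] := f1 (e, c) t.
    by apply: finite_subsingleton => y z /= /xu <- /xu <-.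
  apply: (@sub_finite_set _ _
      ([set y | f y = @GEdge R (double_graph G) (e, false) t] `|`
      [set y | f y = @GEdge R (double_graph G) (e, true) t])).
    by move=> y /=; case: (f y) => // -[e' []] s [-> ->]; [right|left].
  by rewrite finite_setU; split; exact: one.
- exact: radius_gt0.
- move/continuousP: fc => fo i. exact: (fo _ (@open_on_branch i)).
- move=> i y [s [fy si]]; rewrite (star_dist_over_branch fy si).
  by case/andP: si => _ /andP[].
- move=> [[e c] b] [[e' c'] b'] y [s [fy si]] [s' [fy' si']].
  move: fy'; rewrite fy => /GEdge_inj[/= [ee cc] ss'].
  subst e' c' s'; congr (_, _, _).
  exact: (on_branch_side_unique (valP s) si si').
- move=> y yr; have [e [b [s [fy si]]]] := star_dist_cover yr.
  move: fy; case fyE: (f y) => [//|e' s'] /= [ee' ss'].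
  by exists (e', b), s'; split=> //=; rewrite ee' ss'.
- by move=> i y [s [_ /andP[]]].
- move=> i y z [s [fy si]] [s' [fz si']].
  rewrite (star_dist_over_branch fy si) (star_dist_over_branch fz si').
  move=> /(mulfI _) => /(_ (negbT (signr_eq0 _ _))) /addIr /val_inj ss'.
  have [x [_ xu]] := f1 i.1 s.
  by rewrite -(xu y)// -(xu z)// fz ss'.
- move=> i x qi xr; have s01 := branch_interior (i.1.1, i.2) xr.
  have [y [fy _]] := f1 i.1 (exist (fun t => 0 < t < 1) _ s01).
  have si := on_branch_param (h := (i.1.1, i.2)) qi xr.
  exists y; first by exists (exist (fun t => 0 < t < 1) _ s01).
  rewrite (star_dist_over_branch fy si).
  by rewrite /= addrC addKr mulrA -expr2 sqrr_sign mul1r.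
Qed.

Lemma star_dist_overE x : star_dist_over x = 0 <-> undouble (f x) = q.
Proof. exact: star_dist_eq0. Qed.

Lemma height_over (e : 'rV[R]_3) x :
  star_dist_over x = 0 -> height f e x = dotv e (point_map q).
Proof. by rewrite star_dist_overE /height => <-; case: (f x). Qed.

Definition tangent_at (h : edge G * bool) : 'rV[R]_3 :=
  unit_tangent (edge_arc h.1) h.2 (start q h).

Lemma graded_height_over (e : 'rV[R]_3) :
  (forall h, branch q h -> dotv e (tangent_at h) != 0) ->
  graded_height star_dist_over double_branch over_branch (height f e)
    (dotv e (point_map q)) (fun i => 0 < dotv e (tangent_at (i.1.1, i.2))).
Proof.
move=> eT i qi; have [_ /(_ e (eT _ qi))[d d0 dP]] :=
  unit_tangentP (arc_C2 i.1.1) (start_side_ok q (i.1.1, i.2)).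
exists d => // y [s [fy si]]; rewrite (star_dist_over_branch fy si) => sd.
have := dP ((-1) ^+ i.2 * (val s - start q (i.1.1, i.2))).
rewrite sd; case/andP: (si) => _ /andP[-> _] /(_ isT).
rewrite /= mulrA -expr2 sqrr_sign mul1r addrC subrK.
by rewrite (edge_arc_start qi) /height fy.
Qed.

Hypothesis manM : closed_1manifold R M.

(** The two copies of each edge have the same tangent, so the sum over the
    branches in the manifold is twice the sum over the tangents at q. *)
Lemma nlm_sum_chi (e : 'rV[R]_3) :
  (forall h, branch q h -> dotv e (tangent_at h) != 0) ->
  nlm f e q = 2^-1 * \sum_(T <- tangents q) chi T e.
Proof.
move=> eT; have := signed_extrema_count manM branching_over (height_over e)
  (graded_height_over eT).
have setE (A : M -> Prop) : [set x | star_dist_over x = 0 /\ A x] =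
    [set x | undouble (f x) = q /\ A x].
  by apply/seteqP; split => x [/star_dist_overE ? ?].
rewrite !setE /nlm /lmax /lmin => cnt; congr (_ * _).
apply: (mulfI (_ : 2 != 0 :> R)); rewrite ?pnatr_eq0// {}cnt sum_tangents.
transitivity (\sum_(h | branch q h) \sum_(c : bool) chi (tangent_at h) e);
  last first.
  by rewrite mulr_sumr; apply: eq_bigr => h _;
    rewrite big_bool /= -mulr2n mulr_natl.
pose swap (i : (edge G * bool) * bool) := ((i.1.1, i.2), i.1.2).
rewrite pair_big /= (reindex swap)/=.
  apply: eq_big => [i|i qi]; first by rewrite andbT.
  by rewrite /chi lt0r (eT _ qi).
by exists swap => [[[]]|[[]]].
Qed.

End Covering.

(** * Comparison of the integrals *)

Section Integrals.
Variable R : realType.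
Local Notation lam2 := (@lebesgue_measure R \x @lebesgue_measure R)%E.

Lemma great_circles_null (s : seq 'rV[R]_3) : (forall T, T \in s -> T != 0) ->
  exists N, [/\ measurable N, lam2 N = 0%E &
    forall x, polar_rectangle x -> ~ N x ->
      forall T, T \in s -> dotv (sph x.1 x.2) T != 0].
Proof.
elim: s => [_|T s IH s0]; first by exists set0; rewrite measure0.
have [|N [mN N0 sN]] := IH; first by move=> U Us; apply: s0;
  rewrite inE Us orbT.
have T0 : T != 0 by apply: s0; rewrite inE eqxx.
exists (great_circle T `|` N); split.
- by apply: measurableU => //; exact: measurable_great_circle.
- apply/negligibleP.
    by apply: measurableU => //; exact: measurable_great_circle.
  apply: negligibleU; last exact/negligibleP.
  by apply/negligibleP;
    [exact: measurable_great_circle|exact: great_circle_null].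
- move=> x xD /not_orP[xT xN] U; rewrite inE => /predU1P[->|]; last exact: sN.
  by apply/eqP => xT0; apply: xT; split.
Qed.

Lemma measurable_chi_sph (T : 'rV[R]_3) :
  measurable_fun [set: measurableTypeR R * measurableTypeR R]
    (fun x => chi T (sph x.1 x.2)).
Proof.
apply: measurable_fun_ifT => //.
apply: measurable_fun_ler => //.
exact: measurable_dotv_sph.
Qed.

Lemma pospart_ge0 (x : R) : 0 <= pospart x.
Proof. by rewrite /pospart le_max lexx orbT. Qed.

Lemma pospartZ (a x : R) : 0 <= a -> pospart (a * x) = a * pospart x.
Proof. by move=> a0; rewrite /pospart maxr_pMr// mulr0. Qed.

Lemma sphere_integrand_ge0 (f : 'rV[R]_3 -> R) x :
  (forall e, 0 <= f e) -> polar_rectangle x ->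
  (0 <= (f (sph x.1 x.2) * sin x.1)%:E)%E.
Proof.
move=> f0 [/= + _]; rewrite in_itv/= => x1.
by rewrite lee_fin mulr_ge0// sin_ge0_pi.
Qed.

Lemma measurable_sphere_chi (s : seq 'rV[R]_3) :
  measurable_fun (@polar_rectangle R)
    (fun x => (pospart (\sum_(T <- s) chi T (sph x.1 x.2)) * sin x.1)%:E).
Proof.
apply: measurable_funTS; apply/measurable_EFinP; apply: measurable_funM.
  apply: measurable_maxr => //; apply: measurable_sum => T.
  exact: measurable_chi_sph.
have ms : measurable_fun setT (@sin R).
  by apply: continuous_measurable_fun; exact: continuous_sin.
exact: (measurableT_comp ms
  (@measurable_fst _ _ (measurableTypeR R) (measurableTypeR R))).
Qed.

(** The directions orthogonal to some vector of s form finitely many great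
    circles, so f is compared with a * g off a null set. *)
Lemma sphere_integral_scale (a : R) (f g : 'rV[R]_3 -> R) (s : seq 'rV[R]_3) :
  0 <= a -> (forall e, 0 <= f e) -> (forall e, 0 <= g e) ->
  measurable_fun (@polar_rectangle R)
    (fun x => (g (sph x.1 x.2) * sin x.1)%:E) ->
  (forall T, T \in s -> T != 0) ->
  (forall e, (forall T, T \in s -> dotv e T != 0) -> f e = a * g e) ->
  sphere_integral f = (a%:E * sphere_integral g)%E.
Proof.
move=> a0 f0 g0 mg sn0 fg; have [N [mN N0 sN]] := great_circles_null sn0.
rewrite /sphere_integral -/(@polar_rectangle R) -ge0_integralZl_EFin//;
  first last.
- by move=> x; exact: sphere_integrand_ge0.
- exact: measurable_polar_rectangle.
apply: (ge0_eq_integral_off_null _ _ mN N0).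
- by move=> x; exact: sphere_integrand_ge0.
- by move=> x xD; rewrite mule_ge0 ?lee_fin// -?lee_fin;
  exact: sphere_integrand_ge0.
- by move=> x xD xN; rewrite (fg _ (sN _ xD xN)) -EFinM mulrA.
Qed.

End Integrals.

Theorem corollary2 (R : realType) (G : pwC2graph R) (q : gpoint G)
  (M : topologicalType) (f : M -> gpoint (double_graph G)) :
  closed_1manifold R M ->
  parameterization f ->
  ntc q = ((2^-1)%:E * sphere_integral (fun e => pospart (nlm f e q)))%E.
Proof.
move=> manM parf.
pose s := [seq tangent_at q h | h <- enum (branch q)].
have mem_s h : branch q h -> tangent_at q h \in s.
  by move=> qh; apply: map_f; rewrite mem_enum.
have s0 T : T \in s -> T != 0.
  move=> /mapP[h _ ->].
  by have [] := unit_tangentP (arc_C2 h.1) (start_side_ok q h).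
have nlmE e : (forall T, T \in s -> dotv e T != 0) ->
    pospart (nlm f e q) = 2^-1 * pospart (\sum_(T <- tangents q) chi T e).
  move=> es; rewrite (nlm_sum_chi parf manM) ?pospartZ// => h /mem_s; exact: es.
rewrite /ntc (sphere_integral_scale _ _ _ _ s0 nlmE)//.
- rewrite muleA -EFinM; congr (_%:E * _)%E; lra.
- by move=> e; exact: pospart_ge0.
- by move=> e; exact: pospart_ge0.
- exact: measurable_sphere_chi.
Qed.
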